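(* Let $X=W^{\alpha,\psi}_2(\Omega)$ and let $R$ be defined on $X$ by $R(u)=\lambda\int_a^b|D^{\alpha,\psi}_{[a,b]}u|\,dx$. Let $G:X\to\mathbb{R}^m$ be the forward operator, $G_{N_1}$ an $N_1$-dimensional approximation of $G$, and $R_{N_2}$ an $N_2$-dimensional approximation of $R$, and let $$\Phi(u)=\tfrac12\|G(u)-y\|_\Sigma^2,\qquad \Phi_{N_1}(u)=\tfrac12\|G_{N_1}(u)-y\|_\Sigma^2 .$$ Assume that $G$ and $G_{N_1}$ satisfy the following growth condition with constants uniform in $N_1$: for every $\varepsilon>0$ there exists $M=M(\varepsilon)\in\mathbb{R}$ such that, for all $u\in X$ and all $N_1$, $$\|G(u)\|_\Sigma\leqslant\exp(\varepsilon\|u\|_X^2+M),\qquad \|G_{N_1}(u)\|_\Sigma\leqslant\exp(\varepsilon\|u\|_X^2+M).$$ Assume further that for all $\varepsilon>0$ there exist two sequences $\{a_{N_1}(\varepsilon)\}>0$ and $\{b_{N_2}(\varepsilon)\}>0$, both converging to zero, such that $\mu_0(X_\varepsilon)\geqslant 1-\varepsilon$ for all $N_1,N_2$, where $$X_\varepsilon=\left\{u\in X\;\big|\;|\Phi(u)-\Phi_{N_1}(u)|\leqslant a_{N_1}(\varepsilon),\ |R(u)-R_{N_2}(u)|\leqslant b_{N_2}(\varepsilon)\right\}.$$ Let $\mu^y$ and $\mu^y_{N_1,N_2}$ be the measures given by $$\frac{d\mu^y}{d\mu_0}(u)\propto\exp(-\Phi(u)-R(u)),\qquad \frac{d\mu^y_{N_1,N_2}}{d\mu_0}(u)\propto\exp(-\Phi_{N_1}(u)-R_{N_2}(u)).$$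 Then $$d_{Hell}(\mu^y,\mu^y_{N_1,N_2})\to 0\quad\text{as } N_1,N_2\to+\infty.$$
   Context: $\Omega=[a,b]$ is a finite interval, $\alpha>0$ is real, $n=[\alpha]+1$, and $\psi\in C^n(\Omega)$ is an increasing function with $\psi'(x)\neq 0$ for all $x\in\Omega$. The left and right Riemann-Liouville fractional derivatives with respect to $\psi$ are defined, for $f\in C^n(\Omega)$, by $$D^{\alpha,\psi}_{[a,x]}f(x)=\frac{1}{\Gamma(n-\alpha)}\left(\frac{1}{\psi'(x)}\frac{d}{dx}\right)^n\int_a^x\frac{\psi'(t)f(t)\,dt}{(\psi(x)-\psi(t))^{\alpha-n+1}},$$ $$D^{\alpha,\psi}_{[x,b]}f(x)=\frac{1}{\Gamma(n-\alpha)}\left(-\frac{1}{\psi'(x)}\frac{d}{dx}\right)^n\int_x^b\frac{\psi'(t)f(t)\,dt}{(\psi(t)-\psi(x))^{\alpha-n+1}},$$ and the Riesz (Riemann-Liouville) fractional derivative is $$D^{\alpha,\psi}_{[a,b]}f(x)=\tfrac12\left(D^{\alpha,\psi}_{[a,x]}f(x)+(-1)^nD^{\alpha,\psi}_{[x,b]}f(x)\right).$$ $X=W^{\alpha,\psi}_2(\Omega)$ is the space of $u\in L^2(\Omega)$ with $\|u\|_X<+\infty$, where $$\|u\|_X=\left(\int_a^b|u|^2\,dx+\int_a^b|D^{\alpha,\psi}_{[a,b]}u|^2\,dx\right)^{1/2}.$$ This norm is generated by the inner product $\langle u,v\rangle=\int_a^b uv\,dx+\int_a^b(D^{\alpha,\psi}_{[a,b]}u)(D^{\alpha,\psi}_{[a,b]}v)\,dx$,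 and $X$ is taken as a separable Hilbert space. $\lambda>0$ is a regularization parameter, $y\in\mathbb{R}^m$ is the observed data, and the forward operator $G$ is a measurable mapping. $\Sigma$ is the $m\times m$ covariance matrix of the zero-mean Gaussian observation noise, and $\|z\|_\Sigma=\|\Sigma^{-1/2}z\|_2$ for $z\in\mathbb{R}^m$. $\mu_0=\mathcal{N}(0,\mathcal{C}_0)$ is a Gaussian measure on $X$ with zero mean and symmetric positive trace-class covariance operator $\mathcal{C}_0$. The symbol $\propto$ means equality up to a normalization constant. ''$N_1$-dimensional (resp. $N_2$-dimensional) approximation'' is used informally: no condition on $G_{N_1}$ and $R_{N_2}$ is stated beyond those in the claim. The set $X_\varepsilon$ depends on $N_1,N_2$. The Hellinger metric between measures $\mu,\mu'$, with densities taken with respect to a common reference measure $\nu$, is $$d_{Hell}(\mu,\mu')=\sqrt{\frac12\int_X\left(\sqrt{\frac{d\mu}{d\nu}}-\sqrt{\frac{d\mu'}{d\nu}}\right)^2d\nu}.$$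
   Formalization: The formal theorem additionally assumes that the approximations R_{N_2} are bounded below by one constant, uniformly in N_2 and u; without such a condition the claim fails, since R_{N_2} may be very negative on sets of small prior mass. *)

(* Defs.v *)
From HB Require Import structures.
From mathcomp Require Import all_boot all_order all_algebra.
From mathcomp Require Import all_classical all_reals all_analysis.
Set Implicit Arguments.
Unset Strict Implicit.
Unset Printing Implicit Defensive.
Import Order.TTheory GRing.Theory Num.Theory.
Import numFieldTopology.Exports numFieldNormedType.Exports.
Local Open Scope classical_set_scope.
Local Open Scope ring_scope.

Section FractionalDerivative.
Context {R : realType}.
Implicit Types (a b alpha s : R) (psi f g v phi : R -> R).

Local Notation leb := (@lebesgue_measure R).

Definition Gamma (z : R) : R :=
  \int[leb]_(t in `]0, +oo[) (t `^ (z - 1) * expR (- t)).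

Definition frac_order alpha : nat := (Num.truncn alpha).+1.

(* [g 0], ..., [g n] are f and its successive derivatives on [a, b]; at the
   end points they are the continuous extensions, i.e. one-sided derivatives. *)
Definition is_Cn a b n f (g : nat -> R -> R) : Prop :=
  [/\ {in `[a, b], g 0%N =1 f},
      forall k, (k <= n)%N -> {within `[a, b], continuous (g k)} &
      forall k, (k < n)%N -> {in `]a, b[, forall x : R,
        is_derive x 1 (g k) (g k.+1 x)}].

(* psi in C^n([a, b]) is increasing and psi' does not vanish on [a, b]. *)
Definition admissible a b n psi : Prop :=
  {in `[a, b] &, {homo psi : x y / x < y}} /\
  exists2 g, is_Cn a b n psi g & {in `[a, b], forall x, g 1%N x != 0}.

Definition psi_int_left a alpha psi f (x : R) : R :=
  \int[leb]_(t in `[a, x]) (derive1 psi t * f t /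
    (psi x - psi t) `^ (alpha - (frac_order alpha)%:R + 1)).

Definition psi_int_right b alpha psi f (x : R) : R :=
  \int[leb]_(t in `[x, b]) (derive1 psi t * f t /
    (psi t - psi x) `^ (alpha - (frac_order alpha)%:R + 1)).

(* The operator (s / psi') d/dx, with s = 1 or s = -1. *)
Definition psi_diff psi s f (x : R) : R := s / derive1 psi x * derive1 f x.

(* Functions of class C^n with compact support in ]a, b[. *)
Definition test_function a b n phi : Prop :=
  [/\ (forall k, (k < n)%N -> forall x : R, derivable (derive1n k phi) x 1),
      continuous (derive1n n phi) &
      exists c d, [/\ a < c, d < b &
        forall x, x \notin `[c, d] -> phi x = 0]].

(* Elements of W are only L^2 functions, so ((s / psi') d/dx)^n is taken in the
   sense of distributions, with respect to the weight psi' dx: for smooth g and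
   a test function phi, integration by parts gives
     \int ((s / psi') d/dx)^n g * phi * psi'
       = \int g * ((- s / psi') d/dx)^n phi * psi'. *)
Definition psi_diffn_weak a b psi n s g phi : R :=
  \int[leb]_(x in `[a, b])
    (g x * iter n (psi_diff psi (- s)) phi x * derive1 psi x).

Definition rl_left a b alpha psi f phi : R :=
  let n := frac_order alpha in
  (Gamma (n%:R - alpha))^-1 *
    psi_diffn_weak a b psi n 1 (psi_int_left a alpha psi f) phi.

Definition rl_right a b alpha psi f phi : R :=
  let n := frac_order alpha in
  (Gamma (n%:R - alpha))^-1 *
    psi_diffn_weak a b psi n (-1) (psi_int_right b alpha psi f) phi.

Definition riesz_distr a b alpha psi f phi : R :=
  2^-1 * (rl_left a b alpha psi f phi +
          (-1) ^+ frac_order alpha * rl_right a b alpha psi f phi).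

Definition omega_measure a b : {measure set (measurableTypeR R) -> \bar R} :=
  mrestr leb (measurable_itv `[a, b]).

Definition is_riesz_derivative a b alpha psi f v : Prop :=
  v \in Lfun (omega_measure a b) 2%:E /\
  forall phi, test_function a b (frac_order alpha) phi ->
    \int[leb]_(x in `[a, b]) (v x * phi x * derive1 psi x) =
    riesz_distr a b alpha psi f phi.

(* The Riesz derivative is unique up to a null set of [a, b]. *)
Definition riesz_derivative a b alpha psi f : R -> R :=
  xget (cst 0) [set v | is_riesz_derivative a b alpha psi f v].

Definition L2 a b : Type := LspaceType2 (omega_measure a b).

(* The L^2 functions of finite W-norm: the Riesz derivative is in L^2. *)
Definition W2_set a b alpha psi : set (L2 a b) :=
  [set f | exists v, is_riesz_derivative a b alpha psi f v].

Definition W2_dot a b alpha psi f g : R :=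
  \int[leb]_(x in `[a, b]) (f x * g x) +
  \int[leb]_(x in `[a, b])
    (riesz_derivative a b alpha psi f x * riesz_derivative a b alpha psi g x).

Definition W2_penalty a b alpha psi (lambda : R) f : R :=
  lambda * \int[leb]_(x in `[a, b]) `|riesz_derivative a b alpha psi f x|.

End FractionalDerivative.

Definition separable (T : topologicalType) : Prop :=
  exists2 S : set T, countable S & dense S.

(* X, embedded in L^2(a, b) by iota, is the separable Hilbert space
   W^{alpha, psi}_2([a, b]); this determines X up to isometric isomorphism. *)
Record is_W2 (R : realType) (a b alpha : R) (psi : R -> R)
    (X : completeNormedModType R) (iota : X -> L2 a b) : Prop := {
  W2_injective : injective iota ;
  W2_range : range iota = @W2_set R a b alpha psi ;
  W2_linear : forall (c : R) (u v : X),
    (iota (c *: u + v) : R -> R) = (fun x : R => c * iota u x + iota v x)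
      %[ae (omega_measure a b)] ;
  W2_norm : forall u : X,
    `|u| = Num.sqrt (W2_dot a b alpha psi (iota u) (iota u)) ;
  W2_separable : separable X }.

Section Gaussian.
Context {R : realType} (X : completeNormedModType R).

Definition Borel := g_sigma_algebraType (@open X).

Variable dot : X -> X -> R.

Definition orthonormal_basis (e : nat -> X) : Prop :=
  (forall i j, dot (e i) (e j) = (i == j)%:R) /\
  (forall u, (forall i, dot u (e i) = 0) -> u = 0).

(* Symmetric, positive, trace-class operators; X is infinite-dimensional, and
   for a positive operator |C| = C. *)
Definition covariance_operator (C : {linear X -> X}) : Prop :=
  [/\ continuous C,
      forall u v, dot (C u) v = dot u (C v),
      forall u, 0 <= dot (C u) u &
      exists2 e, orthonormal_basis e &
        cvgn [series dot (C (e k)) (e k)]_k].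

(* N(0, s2); [normal_prob] is not the Dirac mass when its deviation is 0. *)
Definition gauss (s2 : R) (A : set R) : \bar R :=
  if s2 == 0 then \d_(0 : R) A else normal_prob 0 (Num.sqrt s2) A.

Definition centered_gaussian (C : X -> X) (mu : probability Borel R) : Prop :=
  forall (h : X) (A : set R), measurable A ->
    mu (dot h @^-1` A) = gauss (dot (C h) h) A.

End Gaussian.

Section DataNorm.
Context {R : realType} {m : nat}.

Definition sym_posdef (S : 'M[R]_m) : Prop :=
  S^T = S /\ forall z : 'cV[R]_m, z != 0 -> 0 < (z^T *m S *m z) 0 0.

(* Sigma^{-1/2}, the symmetric positive definite square root of Sigma^{-1}. *)
Definition inv_sqrtmx (Sigma : 'M[R]_m) : 'M[R]_m :=
  xget 0 [set S | sym_posdef S /\ S *m S = invmx Sigma].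

Definition norm2 (z : 'cV[R]_m) : R := Num.sqrt (\sum_i z i 0 ^+ 2).

Definition norm_cov (Sigma : 'M[R]_m) (z : 'cV[R]_m) : R :=
  norm2 (inv_sqrtmx Sigma *m z).

End DataNorm.

Section Posterior.
Context d (T : measurableType d) (R : realType).
Local Open Scope charge_scope.

(* d mu / d mu0 (u) is proportional to exp (- L u) *)
Definition density_propto_exp (mu0 mu : probability T R) (L : T -> R) : Prop :=
  mu `<< mu0 /\ exists2 Z : R, 0 < Z &
    'd (charge_of_finite_measure mu) '/d mu0 =
      (fun u => (Z^-1 * expR (- L u))%:E) %[ae mu0].

Definition hellinger (nu : {sigma_finite_measure set T -> \bar R})
    (mu mu' : probability T R) : R :=
  Num.sqrt (2^-1 * \int[nu]_u
    (Num.sqrt (fine ('d (charge_of_finite_measure mu) '/d nu u)) -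
     Num.sqrt (fine ('d (charge_of_finite_measure mu') '/d nu u))) ^+ 2).

End Posterior.

(* Main.v *)
Require Import Defs.
From HB Require Import structures.
From mathcomp Require Import all_boot all_order all_algebra.
From mathcomp Require Import all_classical all_reals all_analysis.
From mathcomp Require Import measurable_realfun ring lra.
Set Implicit Arguments.
Unset Strict Implicit.
Unset Printing Implicit Defensive.
Import Order.TTheory GRing.Theory Num.Theory.
Import numFieldTopology.Exports numFieldNormedType.Exports.
Local Open Scope classical_set_scope.
Local Open Scope ring_scope.

(** Both posteriors are Gibbs measures over the prior, with densities
proportional to e^-L and e^-L' for L = Phi + Reg >= 0 and L' = PhiN + RN
bounded below by a constant c. Three estimates give the convergence.

1. The Hellinger distance is controlled by the L^1 distance of the densities:
   (sqrt p - sqrt q)^2 <= |p - q| pointwise ([sqr_sqrtB_le]). The L^1 distance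
   is (twice) the total variation distance, so it depends only on the two
   measures and may be computed with respect to the prior instead of nu
   ([density_dist_le], [hellinger_le_density_dist]).

2. The normalizing constants Z and W need not be compared separately: since
   both densities integrate to one, |Z - W| is at most the L^1 distance of the
   unnormalized densities, whence normalizing costs a factor 2 / Z only
   ([normalized_dist_le]). The only constant entering the bound is Z,
   that of the exact posterior, which does not vary with N1 and N2.

3. The unnormalized densities are close in L^1 of the prior: on the set where
   |L - L'| <= delta they differ by at most e^delta - 1, as e^-L <= 1; on its
   complement, of prior mass at most eps, by at most 1 + e^-c
   ([unnormalized_density_dist_le]).

Together ([gibbs_hellinger_le]) these bound the squared Hellinger distance by
(e^delta - 1 + (1 + e^-c) eps) / Z. Fixing eps first makes the second term
small; then delta = a_N1 + b_N2 tends to zero as N1 and N2 tend to infinity. *)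

(** * Elementary inequalities *)

Section RealInequalities.
Context {R : realType}.

(** For 0 <= x <= y this is sqrt x * sqrt x <= sqrt x * sqrt y. It also holds
for arguments of any sign, the square root of a negative number being 0; this
allows densities that are nonnegative only almost everywhere. *)
Lemma sqr_sqrtB_le (x y : R) :
  (Num.sqrt x - Num.sqrt y) ^+ 2 <= `|x - y|.
Proof.
wlog xy : x y / x <= y => [hwlog|].
  by have [/hwlog//|/ltW/hwlog] := leP x y; rewrite -sqrrN opprB distrC.
have sxy : Num.sqrt x <= Num.sqrt y by rewrite ler_wsqrtr.
rewrite ler0_norm ?subr_le0// opprB.
have [y0|y0] := leP 0 y; last first.
  by rewrite !ler0_sqrtr ?(ltW y0) ?(le_trans xy (ltW y0))//
    subrr expr0n subr_ge0.
have [x0|x0] := leP 0 x.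
  rewrite -{2}(sqr_sqrtr y0) -{2}(sqr_sqrtr x0).
  have := sqrtr_ge0 x; nra.
rewrite (ler0_sqrtr (ltW x0)) sub0r sqrrN (sqr_sqrtr y0); lra.
Qed.

(** The larger of the two exponentials is at most e^delta times the smaller,
so they differ by at most (e^delta - 1) times the smaller, which is at most
e^-s <= 1. *)
Lemma expR_dist_le (delta s t : R) :
  0 <= s -> `|s - t| <= delta ->
  `|expR (- s) - expR (- t)| <= expR delta - 1.
Proof.
move=> s0 /[dup] std; rewrite ler_distl => /andP[h1 h2].
have d0 : 0 <= delta by exact: le_trans std.
have es1 : expR (- s) <= 1 by rewrite -expR0 ler_expR oppr_le0.
have e1 : expR (- t) <= expR delta * expR (- s).
  by rewrite -expRD ler_expR; lra.
have e2 : expR (- s) <= expR delta * expR (- t).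
  by rewrite -expRD ler_expR; lra.
have ed1 : 1 <= expR delta by rewrite -expR0 ler_expR.
have et0 := expR_gt0 (- t).
have es0 := expR_gt0 (- s).
rewrite ler_norml; apply/andP; split; nra.
Qed.

Lemma expR_dist_le_lower_bound (c s t : R) :
  0 <= s -> c <= t -> `|expR (- s) - expR (- t)| <= 1 + expR (- c).
Proof.
move=> s0 ct; rewrite (le_trans (ler_normB _ _))// !gtr0_norm ?expR_gt0//.
by rewrite lerD ?ler_expR ?lerN2// -expR0 ler_expR oppr_le0.
Qed.

End RealInequalities.

(** * Densities and change of reference measure *)

Section Integral.
Context d (T : measurableType d) (R : realType).

Lemma ae_le_Rintegral (mu : {measure set T -> \bar R}) (f g : T -> R) :
  mu.-integrable setT (EFin \o f) -> mu.-integrable setT (EFin \o g) ->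
  (forall x, 0 <= f x) -> (forall x, 0 <= g x) ->
  {ae mu, forall x, f x <= g x} ->
  \int[mu]_x f x <= \int[mu]_x g x.
Proof.
move=> fi gi f0 g0 fg; apply: fine_le.
- exact: integrable_fin_num.
- exact: integrable_fin_num.
apply: ae_ge0_le_integral => //.
- by move=> x _; rewrite lee_fin.
- exact: measurable_int fi.
- by move=> x _; rewrite lee_fin.
- exact: measurable_int gi.
- by apply: filterS fg => x fgx _; rewrite lee_fin.
Qed.

End Integral.

Section Density.
Context d (T : measurableType d) (R : realType).
Local Open Scope charge_scope.
Implicit Types (la : {sigma_finite_measure set T -> \bar R}).
Implicit Types (mu : probability T R).

Definition density la mu (x : T) : R :=
  fine ('d (charge_of_finite_measure mu) '/d la x).

Lemma EFin_density la mu : mu `<< la ->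
  EFin \o density la mu = 'd (charge_of_finite_measure mu) '/d la.
Proof.
by move=> h; apply/funext => x /=; rewrite fineK// Radon_Nikodym_fin_num.
Qed.

Lemma density_integrable la mu A : mu `<< la -> measurable A ->
  la.-integrable A (EFin \o density la mu).
Proof.
move=> h mA; rewrite EFin_density//.
by apply: (integrableS measurableT) => //; exact: Radon_Nikodym_integrable.
Qed.

Lemma Rintegral_density la mu A : mu `<< la -> measurable A ->
  \int[la]_(x in A) density la mu x = fine (mu A).
Proof.
move=> h mA; rewrite /Rintegral -[mu A]/(charge_of_finite_measure mu A).
rewrite (@Radon_Nikodym_integral _ _ _ (charge_of_finite_measure mu) la)//.
congr fine.
by apply: eq_integral => x _; rewrite fineK// Radon_Nikodym_fin_num.
Qed.

Lemma densityB_integrable la mu mu' A : mu `<< la -> mu' `<< la ->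
  measurable A ->
  la.-integrable A (EFin \o (fun x => density la mu x - density la mu' x)).
Proof.
move=> h h' mA.
exact: (integrableB mA (density_integrable h mA) (density_integrable h' mA)).
Qed.

Lemma Rintegral_densityB la mu mu' A : mu `<< la -> mu' `<< la ->
  measurable A ->
  \int[la]_(x in A) (density la mu x - density la mu' x) =
  fine (mu A) - fine (mu' A).
Proof.
move=> h h' mA.
by rewrite RintegralB ?Rintegral_density//; exact: density_integrable.
Qed.

(** On A = {q <= p}, with p and q the densities over nu, the integral of
|p - q| over nu is mu A - mu' A, and on the complement of A it is the opposite
difference. These numbers do not involve nu, and over la each of them is an
integral of a difference of densities, at most that of its absolute value. *)
Lemma density_dist_le (nu la : {sigma_finite_measure set T -> \bar R}) mu mu' :
  mu `<< nu -> mu' `<< nu -> mu `<< la -> mu' `<< la ->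
  \int[nu]_x `|density nu mu x - density nu mu' x| <=
  \int[la]_x `|density la mu x - density la mu' x|.
Proof.
move=> h h' k k'.
have mf : measurable_fun setT (density nu mu).
  by apply/measurable_EFinP; exact: measurable_int (density_integrable h _).
have mf' : measurable_fun setT (density nu mu').
  by apply/measurable_EFinP; exact: measurable_int (density_integrable h' _).
pose A := [set x | density nu mu' x <= density nu mu x].
have mA : measurable A by rewrite -[A]setTI; exact: measurable_fun_ler.
have mCA : measurable (~` A) by exact: measurableC.
have dA : [disjoint A & ~` A] by apply/disj_setPCl.
have split_A (la' : {sigma_finite_measure set T -> \bar R}) :
    mu `<< la' -> mu' `<< la' ->
    \int[la']_x `|density la' mu x - density la' mu' x| =
    \int[la']_(x in A) `|density la' mu x - density la' mu' x| +
    \int[la']_(x in ~` A) `|density la' mu x - density la' mu' x|.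
  move=> l l'; rewrite -Rintegral_setU// setUv//.
  exact/integrable_norm/densityB_integrable.
(* The set A comes from nu; only the values of mu and mu' on A and on its
   complement carry over to la. *)
have -> : \int[nu]_x `|density nu mu x - density nu mu' x| =
    \int[la]_(x in A) (density la mu x - density la mu' x) +
    \int[la]_(x in ~` A) (density la mu' x - density la mu x).
  rewrite split_A// !Rintegral_densityB//; congr +%R.
  - rewrite -(Rintegral_densityB h h' mA); apply: eq_Rintegral => x /set_mem xA.
    by rewrite ger0_norm// subr_ge0.
  - rewrite -(Rintegral_densityB h' h mCA).
    apply: eq_Rintegral => x /set_mem /negP.
    by rewrite -ltNge => /ltW xA; rewrite ler0_norm ?opprB// subr_le0.
rewrite split_A//; apply: lerD; apply: le_Rintegral => //.
- exact: densityB_integrable.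
- exact/integrable_norm/densityB_integrable.
- by move=> x _; exact: ler_norm.
- exact: densityB_integrable.
- exact/integrable_norm/densityB_integrable.
- by move=> x _; rewrite distrC ler_norm.
Qed.

(** The reference measure la is arbitrary, so that the densities of the
posteriors known over the prior can be used whatever measure nu defines the
Hellinger distance. *)
Lemma hellinger_le_density_dist (nu la : {sigma_finite_measure set T -> \bar R})
    mu mu' : mu `<< nu -> mu' `<< nu -> mu `<< la -> mu' `<< la ->
  hellinger nu mu mu' <=
  Num.sqrt (2^-1 * \int[la]_x `|density la mu x - density la mu' x|).
Proof.
move=> h h' k k'; rewrite /hellinger ler_wsqrtr// ler_wpM2l ?invr_ge0//.
apply: le_trans (density_dist_le h h' k k').
have mf : measurable_fun setT (density nu mu).
  by apply/measurable_EFinP; exact: measurable_int (density_integrable h _).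
have mf' : measurable_fun setT (density nu mu').
  by apply/measurable_EFinP; exact: measurable_int (density_integrable h' _).
have ni : nu.-integrable setT
    (EFin \o (fun x => `|density nu mu x - density nu mu' x|)).
  exact/integrable_norm/densityB_integrable.
apply: le_Rintegral => //.
- apply: le_integrable ni => //.
    apply/measurable_EFinP/measurable_funX/measurable_funB;
      apply: measurableT_comp => //;
      exact: continuous_measurable_fun (@sqrt_continuous R).
  move=> x _ /=; rewrite lee_fin normr_id ger0_norm ?sqr_ge0//.
  exact: sqr_sqrtB_le.
- by move=> x _; exact: sqr_sqrtB_le.
Qed.

End Density.

(** * Normalized and unnormalized densities *)

Section Normalization.
Context d (T : measurableType d) (R : realType).
Variable mu : {measure set T -> \bar R}.

(** Z (p - q) = (Z p - W q) + (W - Z) q, and W - Z is the integral of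
W q - Z p, so both terms are controlled by the L^1 norm of Z p - W q. *)
Lemma normalized_dist_le (p q : T -> R) (Z W : R) :
  mu.-integrable setT (EFin \o p) -> mu.-integrable setT (EFin \o q) ->
  0 <= Z -> {ae mu, forall x, 0 <= q x} ->
  \int[mu]_x p x = 1 -> \int[mu]_x q x = 1 ->
  Z * \int[mu]_x `|p x - q x| <= 2 * \int[mu]_x `|Z * p x - W * q x|.
Proof.
move=> pi qi Z0 q0 p1 q1.
pose D x := Z * p x - W * q x.
have Zpi : mu.-integrable setT (EFin \o (fun x => Z * p x)).
  exact: (integrableZl measurableT Z pi).
have Wqi : mu.-integrable setT (EFin \o (fun x => W * q x)).
  exact: (integrableZl measurableT W qi).
have Di : mu.-integrable setT (EFin \o D).
  exact: (integrableB measurableT Zpi Wqi).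
have nDi : mu.-integrable setT (EFin \o (fun x => `|D x|)).
  exact: integrable_norm.
have pqi : mu.-integrable setT (EFin \o (fun x => `|p x - q x|)).
  exact/integrable_norm/(integrableB measurableT pi qi).
have nqi : mu.-integrable setT (EFin \o (fun x => `|q x|)).
  exact: integrable_norm.
have nq1 : \int[mu]_x `|q x| = 1.
  rewrite -q1; congr fine; apply: ae_eq_integral => //.
  - exact: measurable_int nqi.
  - exact: measurable_int qi.
  - by apply: filterS q0 => x qx _; rewrite ger0_norm.
have ZW : `|W - Z| <= \int[mu]_x `|D x|.
  apply: le_trans (le_normr_Rintegral measurableT Di).
  by rewrite RintegralB// !RintegralZl// p1 q1 !mulr1 distrC.
have step : \int[mu]_x (Z * `|p x - q x|) <=
    \int[mu]_x (`|D x| + `|W - Z| * `|q x|).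
  apply: le_Rintegral => //.
  - exact: (integrableZl measurableT Z pqi).
  - exact: (integrableD measurableT nDi
      (integrableZl measurableT `|W - Z| nqi)).
  move=> x _; rewrite -{1}(ger0_norm Z0) -!normrM.
  have -> : Z * (p x - q x) = D x + (W - Z) * q x by rewrite /D; ring.
  exact: ler_normD.
move: step; rewrite RintegralZl// RintegralD//; last first.
  exact: (integrableZl measurableT `|W - Z| nqi).
by rewrite RintegralZl// nq1 mulr1; move: ZW; lra.
Qed.

End Normalization.

(** * Hellinger distance of two Gibbs measures *)

Section GibbsMeasures.
Context d (T : measurableType d) (R : realType).
Variables (mu0 mu mu' : probability T R) (L L' : T -> R) (Z W c : R).
Local Open Scope charge_scope.
Hypotheses (mu_mu0 : mu `<< mu0) (mu'_mu0 : mu' `<< mu0).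
Hypotheses (Z_gt0 : 0 < Z) (W_gt0 : 0 < W).
Hypotheses
  (muE : 'd (charge_of_finite_measure mu) '/d mu0 =
         (fun u => (Z^-1 * expR (- L u))%:E) %[ae mu0])
  (mu'E : 'd (charge_of_finite_measure mu') '/d mu0 =
         (fun u => (W^-1 * expR (- L' u))%:E) %[ae mu0]).
Hypotheses (L_ge0 : forall u, 0 <= L u) (L'_gec : forall u, c <= L' u).

(** The integrand equals |e^-L - e^-L'| almost everywhere for the prior. It is
bounded separately on A, where the potentials are close, and on the complement
of A, which has small mass. *)
Lemma unnormalized_density_dist_le (A : set T) (delta eps : R) :
  measurable A -> (forall u, A u -> `|L u - L' u| <= delta) -> 0 <= delta ->
  ((1 - eps)%:E <= mu0 A)%E ->
  \int[mu0]_x `|Z * density mu0 mu x - W * density mu0 mu' x| <=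
  expR delta - 1 + (1 + expR (- c)) * eps.
Proof.
move=> mA LL' delta0 muA.
have mCA : measurable (~` A) by exact: measurableC.
have e1 : 1 <= expR delta by rewrite -expR0 ler_expR.
have c0 := expR_gt0 (- c).
pose g x : R := (expR delta - 1) + (1 + expR (- c)) * \1_(~` A) x.
have ci : mu0.-integrable setT (EFin \o cst (expR delta - 1)).
  exact: finite_measure_integrable_cst.
have ii : mu0.-integrable setT (EFin \o (\1_(~` A) : T -> R)).
  exact: integrable_indic.
have cii := integrableZl measurableT (1 + expR (- c)) ii.
have gi : mu0.-integrable setT (EFin \o g).
  exact: (integrableD measurableT ci cii).
have Ig : \int[mu0]_x g x =
    expR delta - 1 + (1 + expR (- c)) * fine (mu0 (~` A)).
  rewrite RintegralD// RintegralZl// Rintegral_cst//.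
  rewrite [X in fine X]probability_setT mulr1.
  by congr (_ + _ * _); rewrite /Rintegral integral_indic// setIT.
apply: (@le_trans _ _ (\int[mu0]_x g x)).
  apply: ae_le_Rintegral => //.
  - apply: integrable_norm.
    exact: (integrableB measurableT
      (integrableZl measurableT Z (density_integrable mu_mu0 measurableT))
      (integrableZl measurableT W (density_integrable mu'_mu0 measurableT))).
  - by move=> x; rewrite addr_ge0 ?subr_ge0// mulr_ge0 ?ler0n ?addr_ge0 ?ltW.
  apply: filterS2 muE mu'E => x /(_ I) muEx /(_ I) mu'Ex.
  rewrite /density muEx mu'Ex/= !mulrA !divff ?gt_eqF// !mul1r /g indicE.
  have [xA|xA] := boolP (x \in ~` A).
    rewrite mulr1 (le_trans (expR_dist_le_lower_bound _ (L'_gec x)))//.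
    by rewrite lerDr subr_ge0.
  rewrite mulr0 addr0; apply: expR_dist_le => //; apply: LL'.
  by apply: contrapT => nA; move: xA; rewrite mem_set.
rewrite Ig lerD2l; apply: ler_wpM2l; first by rewrite addr_ge0 ?ltW.
have := muA; rewrite probability_setC//.
by rewrite -[_ A]fineK ?fin_num_measure// -EFinB/= lee_fin; lra.
Qed.

(** The right-hand side is independent of the constant W of the second measure
and involves L' only through its lower bound c, which makes the estimate
uniform over a family of approximations. *)
Lemma gibbs_hellinger_le (nu : {sigma_finite_measure set T -> \bar R})
    (A : set T) (delta eps : R) :
  mu `<< nu -> mu' `<< nu ->
  measurable A -> (forall u, A u -> `|L u - L' u| <= delta) -> 0 <= delta ->
  ((1 - eps)%:E <= mu0 A)%E ->
  hellinger nu mu mu' <=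
  Num.sqrt (Z^-1 * (expR delta - 1 + (1 + expR (- c)) * eps)).
Proof.
move=> mu_nu mu'_nu mA LL' delta0 muA.
apply: le_trans (hellinger_le_density_dist mu_nu mu'_nu mu_mu0 mu'_mu0) _.
have total (m : probability T R) : m `<< mu0 ->
    \int[mu0]_x density mu0 m x = 1.
  by move=> mmu0; rewrite Rintegral_density// probability_setT.
have q0 : {ae mu0, forall x, 0 <= density mu0 mu' x}.
  apply: filterS mu'E => x /(_ I) mu'Ex.
  by rewrite /density mu'Ex/= mulr_ge0 ?invr_ge0 ?expR_ge0 ?ltW.
have := normalized_dist_le W (density_integrable mu_mu0 measurableT)
  (density_integrable mu'_mu0 measurableT) (ltW Z_gt0) q0
  (total _ mu_mu0) (total _ mu'_mu0).
have := unnormalized_density_dist_le mA LL' delta0 muA.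
move=> k1 k2; rewrite ler_wsqrtr// ler_pdivlMl// mulrCA ler_pdivrMl//.
by apply: le_trans k2 _; rewrite ler_pM2l.
Qed.

End GibbsMeasures.

(** * Convergence of the approximate posteriors *)

Theorem theorem3p6 (R : realType)
  (a b alpha lambda : R) (psi : R -> R)
  (ab : a < b) (alpha_gt0 : 0 < alpha) (lambda_gt0 : 0 < lambda)
  (psiP : admissible a b (frac_order alpha) psi)
  (X : completeNormedModType R) (iota : X -> L2 a b)
  (XP : is_W2 alpha psi iota)
  (C0 : {linear X -> X}) (mu0 : probability (Borel X) R)
  (C0P : covariance_operator
    (fun u v => W2_dot a b alpha psi (iota u) (iota v)) C0)
  (mu0P : centered_gaussian
    (fun u v => W2_dot a b alpha psi (iota u) (iota v)) C0 mu0)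
  (m : nat) (y : 'cV[R]_m) (Sigma : 'M[R]_m) (SigmaP : sym_posdef Sigma)
  (G : X -> 'cV[R]_m) (GN : nat -> X -> 'cV[R]_m) (RN : nat -> X -> R)
  (mG : forall i, measurable_fun [set: Borel X] (fun u : Borel X => G u i 0)) :
  let Reg (u : X) := W2_penalty a b alpha psi lambda (iota u) in
  let Phi (u : X) := 2^-1 * norm_cov Sigma (G u - y) ^+ 2 in
  let PhiN (N1 : nat) (u : X) := 2^-1 * norm_cov Sigma (GN N1 u - y) ^+ 2 in
  forall
  (RN_bounded_below : exists c : R, forall N2 u, c <= RN N2 u)
  (growth : forall eps : R, 0 < eps -> exists M : R, forall u : X,
    norm_cov Sigma (G u) <= expR (eps * `|u| ^+ 2 + M) /\
    forall N1, norm_cov Sigma (GN N1 u) <= expR (eps * `|u| ^+ 2 + M))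
  (approx : forall eps : R, 0 < eps -> exists aN bN : nat -> R,
    [/\ (forall N1, 0 < aN N1), (forall N2, 0 < bN N2),
        aN @ \oo --> 0, bN @ \oo --> 0 &
        forall N1 N2,
        let Xeps : set (Borel X) :=
          [set u | `|Phi u - PhiN N1 u| <= aN N1 /\
                   `|Reg u - RN N2 u| <= bN N2] in
        measurable Xeps /\ ((1 - eps)%:E <= mu0 Xeps)%E])
  (muy : probability (Borel X) R)
  (muyN : nat -> nat -> probability (Borel X) R)
  (muyP : density_propto_exp mu0 muy (fun u => Phi u + Reg u))
  (muyNP : forall N1 N2,
    density_propto_exp mu0 (muyN N1 N2) (fun u => PhiN N1 u + RN N2 u))
  (nu : {sigma_finite_measure set (Borel X) -> \bar R})
  (muy_nu : muy `<< nu) (muyN_nu : forall N1 N2, muyN N1 N2 `<< nu),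
  hellinger nu muy (muyN N.1 N.2) @[N --> (\oo, \oo)] --> 0.
Proof.
move=> Reg Phi PhiN [c cRN] growth approx muy muyN [muy0 [Z Z0 muyE]] muyNP
  nu muy_nu muyN_nu.
have Reg_ge0 u : 0 <= Reg u.
  apply: mulr_ge0; first exact: ltW.
  by apply: Rintegral_ge0 => x _; exact: normr_ge0.
have Phi_ge0 u : 0 <= Phi u by rewrite mulr_ge0 ?invr_ge0 ?sqr_ge0.
have PhiN_ge0 N u : 0 <= PhiN N u by rewrite mulr_ge0 ?invr_ge0 ?sqr_ge0.
apply/cvgr0Pnorm_lt => eta eta0.
pose K := 1 + expR (- c).
have K0 : 0 < K by rewrite addr_gt0 ?expR_gt0.
(* eps is chosen so that the mass off Xeps contributes eta^2 / 2 to the bound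
   on the squared distance; N1 and N2 large take care of the other half. *)
pose eps := (Z * eta ^+ 2) / (2 * K).
have eps0 : 0 < eps by rewrite divr_gt0 ?mulr_gt0 ?exprn_gt0.
have Keps : K * eps = Z * eta ^+ 2 / 2.
  by rewrite /eps; field; rewrite gt_eqF.
have [aN [bN [aN0 bN0 acvg bcvg XepsP]]] := approx eps eps0.
have sum_cvg : expR (aN N.1 + bN N.2) @[N --> (\oo, \oo)] --> (1 : R).
  rewrite -expR0; apply: continuous_cvg; first exact: continuous_expR.
  rewrite -[0]addr0; apply: cvgD.
  - exact: (cvg_comp _ _ cvg_fst acvg).
  - exact: (cvg_comp _ _ cvg_snd bcvg).
have h0 : 0 < Z * eta ^+ 2 / 2 by rewrite divr_gt0 ?mulr_gt0 ?exprn_gt0.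
move/cvgrPdist_lt : sum_cvg => /(_ _ h0).
apply: filterS => -[N1 N2] /= small.
have [mX muX] := XepsP N1 N2.
have [muN0 [W W0 muNE]] := muyNP N1 N2.
have delta0 : 0 <= aN N1 + bN N2 by rewrite addr_ge0 ?ltW.
rewrite ger0_norm ?sqrtr_ge0//.
apply: (@le_lt_trans _ _ (Num.sqrt
    (Z^-1 * (expR (aN N1 + bN N2) - 1 + K * eps)))).
  apply: (gibbs_hellinger_le muy0 muN0 Z0 W0 muyE muNE _ _
    muy_nu (muyN_nu N1 N2) mX _ delta0 muX).
  - by move=> u; rewrite addr_ge0.
  - by move=> u; rewrite -[c]add0r lerD.
  - move=> u [hPhi hReg]; rewrite opprD addrACA.
    exact: le_trans (ler_normD _ _) (lerD hPhi hReg).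
rewrite -[ltRHS]ger0_norm ?(ltW eta0)// -sqrtr_sqr.
rewrite ltr_sqrt ?exprn_gt0// ltr_pdivrMl// Keps.
have : expR (aN N1 + bN N2) - 1 < Z * eta ^+ 2 / 2.
  by apply: le_lt_trans small; rewrite distrC ler_norm.
lra.
Qed.
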